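(* Let $\mathcal G=(V,E,\mathbf W)$ be a finite undirected weighted graph with $N$ vertices, and let $\mathbf S$ be a fixed real symmetric graph shift on $\mathcal G$. A random graph signal $\mathbf x$ on $\mathcal G$ is stationary (with respect to $\mathbf S$) if and only if $$\mathbf x=\mathbf H\mathbf e,$$ where $\mathbf H$ is a polynomial filter of $\mathbf S$ and $\mathbf e$ is a standard white noise on $\mathcal G$.
   Context: A graph shift on $\mathcal G$ is a matrix $\mathbf S=[S(i,j)]_{i,j\in V}$ with $S(i,j)=0$ unless $i=j$ or $(i,j)\in E$; here $\mathbf S$ is real and symmetric. A random graph signal is a real random vector indexed by $V$. A polynomial filter of $\mathbf S$ is a matrix of the form $\mathbf H=h(\mathbf S)=h_0\mathbf I+h_1\mathbf S+\dots+h_L\mathbf S^L$ for some polynomial $h(t)=h_0+h_1t+\dots+h_Lt^L$ with real coefficients. A random graph signal $\mathbf x$ is stationary if $\mathbb E\mathbf x=\mathbf 0$ and its covariance matrix $\mathrm{cov}(\mathbf x)=\mathbb E\big((\mathbf x-\mathbb E\mathbf x)(\mathbf x-\mathbb E\mathbf x)^\top\big)=\mathbb E(\mathbf x\mathbf x^\top)$ is a polynomial filter of $\mathbf S$. A standard white noise on $\mathcal G$ is a random graph signal $\mathbf e$ with $\mathbb E(\mathbf e)=\mathbf 0$ and $\mathrm{cov}(\mathbf e)=\mathbf I$, the identity matrix.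
   Formalization: The equality x = He is taken almost surely, and the white noise e may live on an enlarged probability space extending that of x; on the original space the claim fails, e.g. for the zero signal on a one-point space. *)

(* Defs.v *)
From HB Require Import structures.
From mathcomp Require Import all_boot all_order all_algebra.
From mathcomp Require Import all_classical all_reals all_analysis.

Set Implicit Arguments.
Unset Strict Implicit.
Unset Printing Implicit Defensive.

Import Order.TTheory GRing.Theory Num.Theory.
Import numFieldNormedType.Exports.

Local Open Scope classical_set_scope.
Local Open Scope ring_scope.

(* The vertex set is {0, ..., N-1}.  Self-loops are not excluded and weights
   may be any real numbers, extended by zero off the edge set. *)
Record weighted_graph (R : realType) (N : nat) := WeightedGraph {
  edge : rel 'I_N;
  weight : 'M[R]_N;
  edge_sym : symmetric edge;
  weight_sym : weight^T = weight;
  weight_edge : forall i j, ~~ edge i j -> weight i j = 0 }.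

Definition graph_shift (R : realType) (N : nat) (G : weighted_graph R N)
    (S : 'M[R]_N) : Prop :=
  forall i j, ~~ ((i == j) || edge G i j) -> S i j = 0.

(* The sum h_0 I + h_1 S + ... + h_L S^L is written out because [horner_mx]
   is only available for matrices of manifestly positive size. *)
Definition polynomial_filter (R : realType) (N : nat) (S H : 'M[R]_N) : Prop :=
  exists h : {poly R}, H = \sum_(k < size h) h`_k *: S ^+ k.

Section RandomSignals.
Context {d : measure_display} {T : measurableType d} {R : realType}.
Variables (P : probability T R) (N : nat).
Implicit Types (x e : T -> 'cV[R]_N) (S : 'M[R]_N).

Definition coordinate x (i : 'I_N) : T -> R := fun w => x w i 0.

Definition random_signal x : Prop :=
  forall i, measurable_fun setT (coordinate x i).

(* Finite second moments: the mean and the covariance matrix exist, so the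
   uses of [fine] below do not hide infinite or undefined values. *)
Definition second_order x : Prop :=
  forall i, coordinate x i \in Lfun P 2%:E.

Definition mean x : 'cV[R]_N := \col_i fine ('E_P[coordinate x i]).

Definition cov x : 'M[R]_N :=
  \matrix_(i, j) fine (covariance P (coordinate x i) (coordinate x j)).

Definition stationary S x : Prop :=
  [/\ second_order x, mean x = 0 & polynomial_filter S (cov x)].

Definition standard_white_noise e : Prop :=
  [/\ second_order e, mean e = 0 & cov e = 1%:M].

End RandomSignals.

(* [pi : T' -> T] exhibits (T', P') as an extension of the probability space
   (T, P); a random variable [x] on T is identified with [x \o pi] on T'. *)
Definition extension d (T : measurableType d) d' (T' : measurableType d')
    (R : realType) (P : probability T R) (P' : probability T' R)
    (pi : {mfun T' >-> T}) : Prop :=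
  forall A : set T, measurable A -> pushforward P' pi A = P A.

(* x = H e almost surely for a polynomial filter H of S and a standard white
   noise e.  The underlying probability space may be enlarged to carry e: when
   cov x is singular, e needs randomness that need not be available on T (the
   zero signal on a one-point space is stationary, yet no white noise lives
   there).  Taking [pi] to be the identity gives the case where e lives on T. *)
Definition filtered_white_noise d (T : measurableType d) (R : realType)
    (P : probability T R) (N : nat) (S : 'M[R]_N) (x : T -> 'cV[R]_N) : Prop :=
  exists (d' : measure_display) (T' : measurableType d')
         (P' : probability T' R) (pi : {mfun T' >-> T}),
    extension P P' pi /\
    exists (H : 'M[R]_N) (e : T' -> 'cV[R]_N),
      [/\ polynomial_filter S H, standard_white_noise P' e
        & {ae P', forall w, x (pi w) = H *m e w}].

(* Main.v *)
(** If [x = H e] then [cov x = H H^T = H^2], a polynomial in [S].  Conversely,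
    [C = cov x = h(S)] is positive semidefinite; interpolating [sqrt] and
    [1 / sqrt] on its spectrum gives polynomials [H], [K] of [C], hence of [S],
    with [H^2 = C] and [H K H = H].  Take a white noise [z] uncorrelated with
    [x] on an enlarged probability space and put [e = K x + (1 - H K) z].
    Since [H K] is a symmetric projection, [cov e = H K + (1 - H K) = 1], and
    [x - H e = (1 - H K) x] has zero covariance, so it vanishes
    almost surely. *)

Require Import Defs.
From HB Require Import structures.
From mathcomp Require Import all_boot all_order all_algebra.
From mathcomp Require Import spectral sesquilinear complex.
From mathcomp Require Import all_classical all_reals all_analysis.
From mathcomp Require Import measurable_realfun.

Set Implicit Arguments.
Unset Strict Implicit.
Unset Printing Implicit Defensive.

Import Order.TTheory GRing.Theory Num.Theory.

Local Open Scope ring_scope.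

(** * Polynomial functional calculus for real symmetric matrices *)

(** Newton interpolation: each new node is fixed by a multiple of the product of ['X - b%:P] over
    the earlier nodes, which vanishes at those and not at the new one. A repeated node needs no
    correction. *)
Lemma exists_interpolation (F : fieldType) (s : seq F) (f : F -> F) :
  exists p : {poly F}, {in s, forall a, p.[a] = f a}.
Proof.
elim: s => [|a s [p ps]]; first by exists 0.
have [as_|as_] := boolP (a \in s).
  by exists p => b; rewrite inE => /predU1P[->|]; exact: ps.
pose l := \prod_(b <- s) ('X - b%:P).
have la0 : l.[a] != 0 by rewrite -rootE root_prod_XsubC.
exists (p + ((f a - p.[a]) / l.[a])%:P * l) => b.
rewrite inE !hornerE => /predU1P[->|bs]; first by rewrite divfK// addrC subrK.
have /rootP -> : root l b by rewrite root_prod_XsubC.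
by rewrite mulr0 addr0 ps.
Qed.

Lemma trmx_horner_mx (R : comNzRingType) n (A : 'M[R]_n.+1) (p : {poly R}) :
  (horner_mx A p)^T = horner_mx A^T p.
Proof.
elim/poly_ind: p => [|p c IH]; first by rewrite !rmorph0 trmx0.
rewrite !rmorphD !rmorphM /= !horner_mx_X !horner_mx_C linearD/= trmx_mul IH.
(* Transposition has reversed the product, but a polynomial in [A^T] commutes with [A^T]. *)
rewrite tr_scalar_mx; congr (_ + _).
by have := comm_horner_mx2 A^T 'X p; rewrite /GRing.comm horner_mx_X.
Qed.

(** Over the complex numbers [A] is Hermitian, hence unitarily diagonalizable with real spectrum. A
    polynomial acts entrywise on the diagonal factor, and injectivity of the embedding of [R] brings
    the conclusion back to [A]. *)
Lemma symmetric_annihilator (R : rcfType) n (A : 'M[R]_n.+1) :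
  A^T = A ->
  exists2 s : seq R, all (eigenvalue A) s &
    forall p : {poly R}, {in s, forall a, p.[a] = 0} -> horner_mx A p = 0.
Proof.
move=> A_sym; pose f := real_complex R; pose B := map_mx f A.
have B_herm : B \is hermsymmx.
  apply: realsym_hermsym.
    apply/is_hermitianmxP; rewrite expr0 scale1r /B map_trmx A_sym.
    by apply/matrixP => i j; rewrite !mxE.
  by apply/mxOverP => i j; rewrite mxE complex_real.
set P := spectralmx B; set D := spectral_diag B.
have P_unit : P \in unitmx by exact: spectral_unit.
have BE : B = invmx P *m diag_mx D *m P.
  exact/orthomx_spectralP/hermitian_normalmx.
have DE i : D 0 i = f (complex.Re (D 0 i)).
  have /mxOverP/(_ 0 i) := hermitian_spectral_diag_real B_herm.
  by move=> /RRe_real <-.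
exists [seq complex.Re (D 0 i) | i <- enum 'I_n.+1].
  apply/allP => _ /mapP[i _ ->]; rewrite eigenvalue_root_char -(fmorph_root f).
  rewrite map_char_poly /= -/f -/B -DE -eigenvalue_root_char; apply/eigenvalueP.
  (* The rows of [P] are left eigenvectors, nonzero because [P] is invertible. *)
  exists (row i P).
    rewrite -row_mul [B]BE !mulmxA mulmxV// mul1mx row_mul.
    by rewrite row_diag_mx -scalemxAl -rowE.
  apply/eqP => /(congr1 (mulmx^~ (invmx P))).
  rewrite -row_mul mulmxV// mul0mx => /rowP/(_ i)/eqP.
  by rewrite !mxE eqxx oner_eq0.
move=> p ps; apply: (@map_mx_inj _ _ f); rewrite map_horner_mx -/B BE.
rewrite horner_mx_uconjC// horner_mx_diag.
rewrite (_ : map_mx _ D = 0) ?linear0 ?mulmx0 ?mul0mx ?map_mx0//.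
apply/rowP => i; rewrite !mxE DE horner_map ps ?rmorph0//.
by apply/mapP; exists i; rewrite ?mem_enum.
Qed.

Definition psdmx (R : numDomainType) n (A : 'M[R]_n) : Prop :=
  forall u : 'rV[R]_n, 0 <= (u *m A *m u^T) 0 0.

(** For an eigenvector [v] the quadratic form equals [a] times the squared norm of [v], which is
    positive. *)
Lemma psdmx_eigenvalue_ge0 (R : realFieldType) n (A : 'M[R]_n) (a : R) :
  psdmx A -> eigenvalue A a -> 0 <= a.
Proof.
move=> A_psd /eigenvalueP[v vA v0]; have := A_psd v.
rewrite vA -scalemxAl mxE pmulr_lge0// mxE.
have {v0} [i vi0] : exists i, v 0 i != 0 by apply/rV0Pn.
rewrite (bigD1 i)//= ltr_pwDl//.
  by rewrite mxE -expr2 exprn_even_gt0.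
by apply: sumr_ge0 => j _; rewrite mxE -expr2 sqr_ge0.
Qed.

(* [q] and [r] interpolate [sqrt] and [1 / sqrt] on the spectrum; since
   [0^-1 = 0], [r] yields the pseudo-inverse of the square root. *)
Lemma psdmx_sqrt (R : rcfType) n (A : 'M[R]_n.+1) :
  A^T = A -> psdmx A ->
  exists q r : {poly R}, let H := horner_mx A q in let K := horner_mx A r in
    H * H = A /\ H * K * H = H.
Proof.
move=> A_sym A_psd; have [s s_eig sA] := symmetric_annihilator A_sym.
have [q qs] := exists_interpolation s Num.sqrt.
have [r rs] := exists_interpolation s (fun a => (Num.sqrt a)^-1).
exists q, r => H K; split; apply/eqP; rewrite -subr_eq0; apply/eqP.
  have := sA (q * q - 'X); rewrite rmorphB rmorphM /= horner_mx_X; apply.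
  move=> a a_s; rewrite !hornerE qs// -expr2 sqr_sqrtr ?subrr//.
  exact/(psdmx_eigenvalue_ge0 A_psd)/(allP s_eig).
have := sA (q * r * q - q); rewrite rmorphB !rmorphM /=; apply.
move=> a a_s; rewrite !hornerE qs// rs//.
have [->|?] := eqVneq (Num.sqrt a) 0; first by rewrite mulr0 subrr.
by rewrite divff// mul1r subrr.
Qed.

(** * Polynomial filters *)

(** In positive size the explicit sum is a value of the ring morphism [horner_mx], so sums, products
    and compositions of filters come from polynomials. Size zero is split off below, where all
    matrices coincide. *)
Lemma polynomial_filterP (R : realType) n (S H : 'M[R]_n.+1) :
  polynomial_filter S H <-> exists p, H = horner_mx S p.
Proof.
suff E (p : {poly R}) : \sum_(k < size p) p`_k *: S ^+ k = horner_mx S p.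
  by split=> -[p ->]; exists p.
rewrite -[in RHS](coefK p) poly_def raddf_sum /=; apply: eq_bigr => k _.
by rewrite horner_mxZ rmorphXn /= horner_mx_X.
Qed.

Lemma horner_mx_comp (R : comNzRingType) n (A : 'M[R]_n.+1) (p q : {poly R}) :
  horner_mx (horner_mx A q) p = horner_mx A (p \Po q).
Proof.
elim/poly_ind: p => [|p c IH]; first by rewrite comp_poly0 !rmorph0.
rewrite comp_polyD comp_polyM comp_polyX comp_polyC.
by rewrite !rmorphD !rmorphM /= IH !horner_mx_C horner_mx_X.
Qed.

Lemma polynomial_filter_sym (R : realType) n (S H : 'M[R]_n) :
  S^T = S -> polynomial_filter S H -> H^T = H.
Proof.
case: n => [|n] in S H *; first by move=> _ _; apply/matrixP => -[].
by move=> S_sym /polynomial_filterP[p ->]; rewrite trmx_horner_mx S_sym.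
Qed.

Lemma polynomial_filter_sqr (R : realType) n (S H : 'M[R]_n) :
  polynomial_filter S H -> polynomial_filter S (H *m H).
Proof.
case: n => [|n] in S H *.
  by move=> _; exists 0; apply/matrixP => -[].
case/polynomial_filterP => p ->; apply/polynomial_filterP; exists (p * p).
by rewrite rmorphM.
Qed.

(** The root and its pseudo-inverse are polynomials in [C], so they commute; since [C] is a
    polynomial in [S], composition makes them polynomials in [S]. *)
Lemma polynomial_filter_sqrt (R : realType) n (S C : 'M[R]_n) :
    S^T = S -> psdmx C -> polynomial_filter S C ->
  exists H K : 'M[R]_n,
    [/\ polynomial_filter S H, polynomial_filter S K, H *m H = C,
        H *m K *m H = H & H *m K = K *m H].
Proof.
case: n => [|n] in S C *.
  move=> _ _ _; exists 0, 0.
  by split; do ?[exists 0]; apply/matrixP => -[].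
move=> S_sym C_psd SC; have C_sym := polynomial_filter_sym S_sym SC.
have [q [r [qq qrq]]] := psdmx_sqrt C_sym C_psd.
case/polynomial_filterP: SC => h Ch.
exists (horner_mx C q), (horner_mx C r); split=> //.
- by apply/polynomial_filterP; exists (q \Po h); rewrite Ch horner_mx_comp.
- by apply/polynomial_filterP; exists (r \Po h); rewrite Ch horner_mx_comp.
- exact: comm_horner_mx2.
Qed.

(** * Square-integrable random variables *)

Section second_moments.
Local Open Scope classical_set_scope.
Context d (T : measurableType d) (R : realType) (P : probability T R).
Implicit Types f g : T -> R.

(** This form involves a single nonnegative integral, suited to changes of variables and to almost
    sure equality. *)
Lemma Lfun2P f : f \in Lfun P 2%:E <->
  measurable_fun setT f /\ (\int[P]_w (f w ^+ 2)%:E < +oo)%E.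
Proof.
split=> [f2|[mf f2]].
  split; first by move: f2; rewrite inE => /andP[]; rewrite inE.
  have /integrableP[_] := Lfun2_integrable_sqr f2; apply: le_lt_trans.
  rewrite le_eqVlt; apply/orP; left; apply/eqP; apply: eq_integral => w _.
  by rewrite /= ger0_norm ?sqr_ge0.
rewrite inE; apply/andP; split; rewrite inE//=.
rewrite /finite_norm unlock poweR_lty//; move: f2; apply: le_lt_trans.
rewrite le_eqVlt; apply/orP; left; apply/eqP; apply: eq_integral => w _.
by rewrite /= powR_mulrn// -normrX ger0_norm ?sqr_ge0.
Qed.

Lemma Lfun2_measurable f : f \in Lfun P 2%:E -> measurable_fun setT f.
Proof. by case/Lfun2P. Qed.

Lemma Lfun2_Lfun1 f : f \in Lfun P 2%:E -> f \in Lfun P 1.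
Proof. by apply: Lfun_subset12; exact: fin_num_measure. Qed.

Lemma Lfun_sum (p : \bar R) n (c : 'I_n -> R) (f : 'I_n -> T -> R) :
  (1 <= p)%E -> (forall i, f i \in Lfun P p) ->
  (fun w => \sum_i c i * f i w) \in Lfun P p.
Proof.
move=> p1 fp; have [S0 SD] := @Lfun_submod_closed _ T R P p p1.
have -> : (fun w => \sum_i c i * f i w) = \sum_i c i *: f i.
  by apply/funext => w; rewrite fct_sumE.
elim/big_rec: _ => [|i g _ IH]; first exact: S0.
exact: SD.
Qed.

Lemma Lfun2_centered f c : f \in Lfun P 2%:E -> f \- cst c \in Lfun P 2%:E.
Proof.
move=> f2; have p1 : (1 <= 2%:E :> \bar R)%E by rewrite lee_fin ler1n.
have [_ SD] := @Lfun_submod_closed _ T R P 2%:E p1.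
rewrite (_ : _ \- _ = (-1) *: cst c + f) ?SD ?Lfun_cst//.
by apply/funext => w /=; rewrite addrC scaleN1r.
Qed.

(** Integrability makes every expectation finite, so [fine] commutes with the sums and products. *)
Lemma fine_expectation_sum n (c : 'I_n -> R) (f : 'I_n -> T -> R) :
  (forall i, f i \in Lfun P 1) ->
  fine 'E_P[fun w => \sum_i c i * f i w] = \sum_i c i * fine 'E_P[f i].
Proof.
move=> f1; have fi i : P.-integrable setT (fun w => (f i w)%:E).
  exact/Lfun1_integrable.
rewrite unlock; under eq_integral do rewrite -sumEFin.
rewrite integral_sum//= => [|i]; last first.
  by under eq_fun do rewrite EFinM; exact: integrableZl.
rewrite -sum_fine => [|i _]; last first.
  under eq_integral do rewrite EFinM.
  by rewrite integralZl// fin_numM// integrable_fin_num.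
apply: eq_bigr => i _.
under eq_integral do rewrite EFinM.
by rewrite integralZl// fineM// integrable_fin_num.
Qed.

End second_moments.

(** * Mean and covariance of random signals *)

Section signals.
Local Open Scope classical_set_scope.
Context d (T : measurableType d) (R : realType) (P : probability T R).

Let centered n (x : T -> 'cV[R]_n) i : T -> R :=
  coordinate x i \- cst (mean P x i 0).

Let centered_mul_Lfun1 n (x : T -> 'cV[R]_n) i j : second_order P x ->
  (fun w => centered x i w * centered x j w) \in Lfun P 1.
Proof.
by move=> x2; apply: Lfun2_mul_Lfun1; apply: Lfun2_centered; exact: x2.
Qed.

Let covE n (x : T -> 'cV[R]_n) i j :
  cov P x i j = fine 'E_P[fun w => centered x i w * centered x j w].
Proof. by rewrite mxE unlock /centered !mxE. Qed.

Lemma cov_mean0 n (x : T -> 'cV[R]_n) i j : mean P x = 0 ->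
  cov P x i j = fine 'E_P[fun w => coordinate x i w * coordinate x j w].
Proof.
move=> xm; rewrite covE (_ : (fun w => centered x i w * _) =
  fun w => coordinate x i w * coordinate x j w)//.
by apply/funext => w; rewrite /centered xm !mxE /= !subr0.
Qed.

Lemma coordinate_mulmx m n (A : 'M[R]_(m, n)) (x : T -> 'cV[R]_n) i :
  coordinate (fun w => A *m x w) i = fun w => \sum_k A i k * coordinate x k w.
Proof. by apply/funext => w; rewrite /coordinate mxE. Qed.

Lemma second_order_mulmx m n (A : 'M[R]_(m, n)) (x : T -> 'cV[R]_n) :
  second_order P x -> second_order P (fun w => A *m x w).
Proof.
by move=> x2 i; rewrite coordinate_mulmx Lfun_sum// lee_fin ler1n.
Qed.

Lemma mean_mulmx m n (A : 'M[R]_(m, n)) (x : T -> 'cV[R]_n) :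
  second_order P x -> mean P (fun w => A *m x w) = A *m mean P x.
Proof.
move=> x2; apply/colP => i; rewrite !mxE coordinate_mulmx.
rewrite fine_expectation_sum => [|k]; last exact/Lfun2_Lfun1/x2.
by apply: eq_bigr => k _; rewrite mxE.
Qed.

Lemma cov_mulmx m n (A : 'M[R]_(m, n)) (x : T -> 'cV[R]_n) :
  second_order P x -> cov P (fun w => A *m x w) = A *m cov P x *m A^T.
Proof.
move=> x2; apply/matrixP => i j; rewrite covE.
have cE k w : centered (fun w => A *m x w) k w = \sum_l A k l * centered x l w.
  rewrite /centered mean_mulmx// /cst /= coordinate_mulmx mxE -sumrB.
  by apply: eq_bigr => l _; rewrite mulrBr.
(* The double sum is kept nested, so that linearity of the expectation applies once per index. *)
transitivity (fine 'E_P[fun w => \sum_k A i k *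
    (\sum_l A j l * (centered x k w * centered x l w))]).
  congr (fine (expectation _ _)); apply/funext => w; rewrite !cE mulr_suml.
  apply: eq_bigr => k _; rewrite -mulrA mulr_sumr; congr (_ * _).
  by apply: eq_bigr => l _; rewrite mulrCA.
rewrite fine_expectation_sum => [|k]; last first.
  rewrite (Lfun_sum (A j) (f := fun l w => centered x k w * centered x l w))//.
  by move=> l; exact: centered_mul_Lfun1.
rewrite -mulmxA mxE; apply: eq_bigr => k _; congr (_ * _).
rewrite (fine_expectation_sum (A j)
  (f := fun l w => centered x k w * centered x l w)) => [|l].
  by rewrite mxE; apply: eq_bigr => l _; rewrite covE mxE mulrC.
exact: centered_mul_Lfun1.
Qed.

(** The quadratic form at [u] is the variance of the scalar signal [u *m x]. *)
Lemma psdmx_cov n (x : T -> 'cV[R]_n) : second_order P x -> psdmx (cov P x).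
Proof.
move=> x2 u; rewrite -cov_mulmx// covE fine_ge0// expectation_ge0// => w.
by rewrite -expr2 sqr_ge0.
Qed.

Lemma ae_eq_expectation (f g : T -> R) :
    measurable_fun setT f -> measurable_fun setT g ->
  {ae P, forall w, f w = g w} -> ('E_P[f] = 'E_P[g])%E.
Proof.
move=> mf mg fg; rewrite unlock; apply: ae_eq_integral => //.
- exact/measurable_EFinP.
- exact/measurable_EFinP.
- by apply: filterS fg => w -> _.
Qed.

(** Measurability of [x] is a separate hypothesis because almost sure equality does not transfer it
    when the measure is not complete. *)
Lemma ae_eq_second_order n (x y : T -> 'cV[R]_n) :
    random_signal x -> second_order P y -> {ae P, forall w, x w = y w} ->
  [/\ second_order P x, mean P x = mean P y & cov P x = cov P y].
Proof.
move=> mx y2 xy.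
have my : random_signal y by move=> i; exact/Lfun2_measurable/y2.
have x2 : second_order P x.
  move=> i; apply/Lfun2P; split; first exact: mx.
  have /Lfun2P[_] := y2 i; apply: le_lt_trans.
  rewrite le_eqVlt; apply/orP; left; apply/eqP; apply: ae_eq_integral => //.
  - by apply/measurable_EFinP/measurable_funX/mx.
  - by apply/measurable_EFinP/measurable_funX/my.
  - by apply: filterS xy => w; rewrite /coordinate => ->.
have xym : mean P x = mean P y.
  apply/colP => i; rewrite !mxE; congr fine; apply: ae_eq_expectation => //.
  by apply: filterS xy => w; rewrite /coordinate => ->.
split=> //; apply/matrixP => i j; rewrite !covE; congr fine.
apply: ae_eq_expectation.
- by apply: measurable_funM; apply: measurable_funB.
- by apply: measurable_funM; apply: measurable_funB.
by apply: filterS xy => w; rewrite /centered /coordinate xym /= => ->.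
Qed.

(** The diagonal of the covariance gives each coordinate a zero second moment, so it vanishes off a
    null set; there are finitely many coordinates. *)
Lemma ae_eq0_cov0 n (x : T -> 'cV[R]_n) :
    second_order P x -> mean P x = 0 -> cov P x = 0 ->
  {ae P, forall w, x w = 0}.
Proof.
move=> x2 xm xc.
have x0 i : {ae P, forall w, coordinate x i w = 0}.
  have mxi := Lfun2_measurable (x2 i).
  have sq1 : (fun w => coordinate x i w ^+ 2) \in Lfun P 1.
    exact: Lfun2_mul_Lfun1.
  have : ('E_P[fun w => (coordinate x i w ^+ 2)%R] = 0)%E.
    (* Finiteness matters here: [fine] also sends infinite values to 0. *)
    rewrite -[LHS]fineK ?expectation_fin_num//; congr EFin.
    have := cov_mean0 i i xm; rewrite xc mxE => /esym; exact.
  rewrite unlock => Ex0.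
  have /(ae_eq_integral_abs P measurableT)[+ _] : measurable_fun setT
      (fun w => (coordinate x i w ^+ 2)%:E).
    exact/measurable_EFinP/measurable_funX.
  move=> /(_ _)/wrap[].
    rewrite -[RHS]Ex0; apply: eq_integral => w _.
    by rewrite gee0_abs// lee_fin sqr_ge0.
  by apply: filterS => w /(_ I)[]/eqP; rewrite sqrf_eq0 => /eqP.
have : {ae P, forall w, forall i, coordinate x i w = 0}.
  exact: filter_forall.
by apply: filterS => w xw; apply/colP => i; rewrite mxE; exact: xw.
Qed.

End signals.

(** * Extensions of the probability space: transfer of moments, then a space carrying noise *)

Section extensions.
Local Open Scope classical_set_scope.
Context d (T : measurableType d) d' (T' : measurableType d') (R : realType).
Variables (P : probability T R) (P' : probability T' R) (pi : {mfun T' >-> T}).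
Hypothesis PP' : extension P P' pi.

Let integral_extension (f : T -> \bar R) :
  (\int[pushforward P' pi]_w f w = \int[P]_w f w)%E.
Proof. by apply: eq_measure_integral => A mA _; exact: PP'. Qed.

(** Change of variables for the nonnegative square holds without integrability, which gives both
    directions at once. *)
Lemma extension_Lfun2 (f : T -> R) : measurable_fun setT f ->
  f \o pi \in Lfun P' 2%:E <-> f \in Lfun P 2%:E.
Proof.
move=> mf; rewrite !Lfun2P -integral_extension ge0_integral_pushforward//.
- rewrite preimage_setT; split=> -[_ h]; split=> //.
  exact: measurableT_comp.
- by apply/measurable_EFinP/measurable_funX.
- by move=> w _; rewrite lee_fin sqr_ge0.
Qed.

Lemma extension_expectation (f : T -> R) :
    measurable_fun setT f -> f \o pi \in Lfun P' 1 ->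
  ('E_P'[f \o pi] = 'E_P[f])%E.
Proof.
move=> mf /Lfun1_integrable f1.
rewrite unlock -integral_extension integral_pushforward//.
exact/measurable_EFinP.
Qed.

Lemma extension_random_signal n (x : T -> 'cV[R]_n) :
  random_signal x -> random_signal (x \o pi).
Proof. by move=> mx i; apply: (measurableT_comp (mx i)). Qed.

Lemma extension_second_order n (x : T -> 'cV[R]_n) : random_signal x ->
  second_order P' (x \o pi) <-> second_order P x.
Proof. by move=> mx; split=> x2 i; apply/(extension_Lfun2 (mx i))/x2. Qed.

Lemma extension_mean n (x : T -> 'cV[R]_n) :
  random_signal x -> second_order P' (x \o pi) -> mean P' (x \o pi) = mean P x.
Proof.
move=> mx x2; apply/colP => i; rewrite !mxE.
by rewrite -(extension_expectation (mx i))//; exact/Lfun2_Lfun1/x2.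
Qed.

Lemma extension_cov n (x : T -> 'cV[R]_n) :
  random_signal x -> second_order P' (x \o pi) -> cov P' (x \o pi) = cov P x.
Proof.
move=> mx x2; apply/matrixP => i j; rewrite !mxE unlock; congr fine.
have := extension_mean mx x2 => /colP xm.
have := xm i; have := xm j; rewrite !mxE => -> ->.
rewrite -[RHS]extension_expectation//.
- exact: (measurable_funM (measurable_funB (mx i) (measurable_cst _))
    (measurable_funB (mx j) (measurable_cst _))).
- by apply: Lfun2_mul_Lfun1; apply: Lfun2_centered; exact: x2.
Qed.

End extensions.

(* The extra randomness is a uniform draw of a sign [b] and an index [k <= N];
   the noise [sqrt N.+1 * (-1)^b * e_k] is only uncorrelated, which is all that
   second-order statements require.  The index [k = N], where the noise is [0],
   keeps the probability well defined when [N = 0]. *)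
Section noise_extension.
Local Open Scope classical_set_scope.
Context d (T : measurableType d) (R : realType) (P : probability T R) (N : nat).
Local Notation T' := (T * (bool * nat))%type.

Definition noise_slice (b : bool) (k : nat) (w : T) : T' := (w, (b, k)).

Let measurable_noise_slice b k : measurable_fun setT (noise_slice b k).
Proof. by apply: measurable_fun_pair => //; exact: measurable_cst. Qed.

HB.instance Definition _ b k :=
  isMeasurableFun.Build _ _ _ _ (noise_slice b k) (measurable_noise_slice b k).

Definition noise_sum (b : bool) : {measure set T' -> \bar R} :=
  msum (fun k => distribution P (noise_slice b k)) N.+1.

Let weight_ge0 : 0 <= (2 * N.+1%:R)^-1 :> R.
Proof. by rewrite invr_ge0 mulr_ge0. Qed.

(** The average of the images of [P] under the slices with [k <= N], that is, the product of [P]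
    with a uniform law. Written so, every probability is a finite sum, as in [noise_probE]. *)
Definition noise_prob : set T' -> \bar R :=
  mscale (NngNum weight_ge0) (measure_add (noise_sum true) (noise_sum false)).

HB.instance Definition _ := Measure.on noise_prob.

Lemma noise_probE A : noise_prob A = ((2 * N.+1%:R)^-1%:E *
  (\sum_(k < N.+1) P (noise_slice true k @^-1` A) +
   \sum_(k < N.+1) P (noise_slice false k @^-1` A)))%E.
Proof.
by rewrite /noise_prob /mscale; congr (_ * _)%E; exact: measure_addE.
Qed.

Let noise_prob_setT : noise_prob setT = 1%E.
Proof.
rewrite noise_probE; under eq_bigr do rewrite preimage_setT probability_setT.
rewrite sumEFin sumr_const card_ord -EFinD -EFinM; congr EFin.
by rewrite -mulr2n -[X in _ * X]mulr_natl mulVf// mulf_neq0// pnatr_eq0.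
Qed.

HB.instance Definition _ :=
  Measure_isProbability.Build _ _ _ noise_prob noise_prob_setT.

Definition noise_fst (t : T') : T := t.1.
HB.instance Definition _ :=
  isMeasurableFun.Build _ _ _ _ noise_fst measurable_fst.

Lemma noise_extension : extension P noise_prob noise_fst.
Proof.
move=> A mA; apply: etrans; first exact: noise_probE.
transitivity ((2 * N.+1%:R)^-1%:E *
    (\sum_(k < N.+1) P A + \sum_(k < N.+1) P A))%E.
  (* [noise_fst] undoes each slice by computation, so every preimage is [A] itself. *)
  by [].
rewrite -(fineK (fin_num_measure P A mA)) sumEFin sumr_const card_ord.
rewrite -EFinD -EFinM; congr EFin; rewrite -mulr2n -[fine _ *+ N.+1]mulr_natl.
by rewrite -[X in _ * X]mulr_natl [X in _ * X]mulrA mulKf//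
  mulf_neq0// pnatr_eq0.
Qed.

Definition noise_flip (t : T') : T' := (t.1, (~~ t.2.1, t.2.2)).

Let measurable_noise_flip : measurable_fun setT noise_flip.
Proof.
apply: measurable_fun_pair => //.
apply: measurable_fun_pair; last exact: measurableT_comp.
by apply: (measurableT_comp (f := negb)) => //; exact: measurableT_comp.
Qed.

HB.instance Definition _ :=
  isMeasurableFun.Build _ _ _ _ noise_flip measurable_noise_flip.

(** The flip exchanges the slices of the two signs, hence the two sums in [noise_probE]. *)
Lemma noise_flip_extension : extension noise_prob noise_prob noise_flip.
Proof.
move=> A mA; apply: etrans; first exact: noise_probE.
by apply/esym; apply: etrans; [exact: noise_probE|rewrite addeC].
Qed.

Definition noise (t : T') : 'cV[R]_N :=
  \col_j ((-1) ^+ t.2.1 * (Num.sqrt N.+1%:R * (t.2.2 == j)%:R)).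

Let noise_support (j : 'I_N) : set T' := [set t | t.2.2 = j :> nat].

Let measurable_noise_support j : measurable (noise_support j).
Proof.
have /(_ measurableT [set nat_of_ord j]) :
    measurable_fun setT (fun t : T' => t.2.2) by exact: measurableT_comp.
by rewrite setTI; apply.
Qed.

Lemma noise_prob_support j : noise_prob (noise_support j) = (N.+1%:R^-1)%:E.
Proof.
(* Among the slices of sign [b], the one with [k = j] lies inside the support and all others miss
   it. *)
have E b : (\sum_(k < N.+1) P (noise_slice b k @^-1` noise_support j) = 1)%E.
  rewrite (bigD1 (widen_ord (leqnSn N) j))//= big1 => [|k kj].
    rewrite adde0 -(probability_setT P); congr (P _).
    by apply/seteqP; split.
  rewrite -(measure0 P); congr (P _); apply/seteqP; split=> // w /= kE.
  by move/eqP: kj; apply; exact: val_inj.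
rewrite noise_probE !E -EFinD -EFinM; congr EFin.
by rewrite invfM -mulrA mulrCA mulVf ?mulr1// pnatr_eq0.
Qed.

Lemma random_signal_noise : random_signal noise.
Proof.
move=> j; rewrite /coordinate.
have -> : (fun t => noise t j 0) = fun t : T' =>
    (-1) ^+ t.2.1 * (Num.sqrt N.+1%:R * \1_(noise_support j) t) :> R.
  apply/funext => t; rewrite mxE indicE; congr (_ * (_ * _%:R)).
  by congr nat_of_bool; apply/eqP/idP; rewrite inE.
apply: measurable_funM; last first.
  by apply: measurable_funM => //; exact: measurable_indic.
apply: (measurableT_comp (f := fun b : bool => (-1) ^+ b : R)) => //.
exact: measurableT_comp.
Qed.

(** Two distinct coordinates are never nonzero together. On the diagonal the sign squares away, and
    the squared scale [N.+1] cancels the probability of the index. *)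
Lemma expectation_noise_mul i j :
  ('E_noise_prob[(fun t => noise t i 0 * noise t j 0)%R] = ((i == j)%:R)%:E)%E.
Proof.
have [<-|ij] := eqVneq i j; last first.
  rewrite -[RHS](expectation_cst noise_prob); congr expectation.
  apply/funext => t; rewrite !mxE; have [ti|_] := eqVneq t.2.2 i; last by rewrite !mulr0 mul0r.
  have [tj|_] := eqVneq t.2.2 j; last by rewrite !mulr0.
  by move/eqP: ij => []; apply: val_inj; rewrite /= -ti -tj.
transitivity ('E_noise_prob[N.+1%:R \o* \1_(noise_support i)])%E.
  congr expectation; apply/funext => t; rewrite !mxE /= indicE.
  have -> : (t \in noise_support i) = (t.2.2 == i).
    by apply/idP/eqP; rewrite inE.
  rewrite mulrACA -expr2 sqrr_sign mul1r mulrACA -expr2 sqr_sqrtr//.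
  by case: eqP => _; rewrite !(mulr1, mulr0, mul1r, mul0r).
rewrite expectationZl; last first.
  apply/Lfun1_integrable; exact: integrable_indic.
transitivity (N.+1%:R%:E * (N.+1%:R^-1)%:E : \bar R)%E.
  by rewrite expectation_indic//; congr (_ * _)%E; exact: noise_prob_support.
by rewrite -EFinM divff// pnatr_eq0.
Qed.

Lemma second_order_noise : second_order noise_prob noise.
Proof.
move=> j; apply/Lfun2P; split; first exact: random_signal_noise.
have := expectation_noise_mul j j; rewrite unlock => ->.
by rewrite ltry.
Qed.

Lemma noise_flipE t : noise (noise_flip t) = - noise t.
Proof.
by apply/colP => j; rewrite !mxE /= signrN mulNr.
Qed.

(* Flipping the sign preserves [noise_prob] and negates [f]. *)
Lemma expectation_odd (f : T' -> R) : f \in Lfun noise_prob 1 ->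
  (forall t, f (noise_flip t) = - f t) -> fine 'E_noise_prob[f] = 0.
Proof.
move=> f1 fN.
have mf : measurable_fun setT f.
  by move: f1; rewrite inE => /andP[]; rewrite inE.
have fE : f \o noise_flip = -1 \o* f.
  by apply/funext => t; rewrite /= fN mulrN1.
have := extension_expectation noise_flip_extension mf.
rewrite fE expectationZl// => /(_ _)/wrap[].
  by apply: Lfun_scale.
move/(congr1 fine); rewrite fineM ?expectation_fin_num//= mulN1r => /eqP.
by rewrite eq_sym -subr_eq0 opprK -mulr2n mulrn_eq0 => /eqP.
Qed.

End noise_extension.

Arguments noise_fst {d T}.
Arguments noise {d T} R N.

(** * The signal stacked with the noise *)

Section joint.
Context d (T : measurableType d) (R : realType) (P : probability T R) (N : nat).
Variable x : T -> 'cV[R]_N.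
Hypotheses (mx : random_signal x) (x2 : second_order P x) (xm : mean P x = 0).

(** Stacking turns both the white noise sought and its residual into linear images of one signal, so
    [mean_mulmx] and [cov_mulmx] compute their moments by block algebra. *)
Definition joint_noise (t : T * (bool * nat)) : 'cV[R]_(N + N) :=
  col_mx (x (noise_fst t)) (noise R N t).

Local Notation P' := (noise_prob P N).

Let x'2 : second_order P' (x \o noise_fst).
Proof. exact/(extension_second_order (noise_extension P N) mx). Qed.

Let coordinatel i :
  coordinate joint_noise (lshift N i) = coordinate (x \o noise_fst) i.
Proof. by apply/funext => t; rewrite /coordinate col_mxEu. Qed.

Let coordinater i :
  coordinate joint_noise (rshift N i) = coordinate (noise R N) i.
Proof. by apply/funext => t; rewrite /coordinate col_mxEd. Qed.

Lemma second_order_joint_noise : second_order P' joint_noise.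
Proof.
move=> i; case: (split_ordP i) => k ->; rewrite ?coordinatel ?coordinater//.
exact: second_order_noise.
Qed.

Lemma mean_joint_noise : mean P' joint_noise = 0.
Proof.
apply/colP => i; rewrite !mxE; case: (split_ordP i) => k ->.
  rewrite coordinatel; have := extension_mean (noise_extension P N) mx x'2.
  by rewrite xm => /colP/(_ k); rewrite !mxE.
rewrite coordinater; apply: expectation_odd.
  exact/Lfun2_Lfun1/second_order_noise.
by move=> t; rewrite /coordinate noise_flipE mxE.
Qed.

(** The off-diagonal blocks vanish by parity: [noise_flip] fixes the point of [T] and negates the
    noise, so each cross product is odd. *)
Lemma cov_joint_noise : cov P' joint_noise = block_mx (cov P x) 0 0 1%:M.
Proof.
have cross k l : fine 'E_P'[fun t =>
    coordinate (x \o noise_fst) k t * coordinate (noise R N) l t] = 0.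
  apply: expectation_odd => [|t].
    by apply: Lfun2_mul_Lfun1; [exact: x'2|exact: second_order_noise].
  by rewrite /coordinate noise_flipE mxE mulrN.
have x'm : mean P' (x \o noise_fst) = 0.
  by rewrite (extension_mean (noise_extension P N)).
apply/matrixP => i j; rewrite cov_mean0; last exact: mean_joint_noise.
case: (split_ordP i) => k ->; case: (split_ordP j) => l ->;
  rewrite ?coordinatel ?coordinater.
- rewrite block_mxEul -cov_mean0//.
  by rewrite (extension_cov (noise_extension P N)).
- by rewrite block_mxEur mxE.
- rewrite block_mxEdl mxE -[RHS](cross l k); congr (fine (expectation _ _)).
  by apply/funext => t; rewrite mulrC.
- by rewrite block_mxEdr mxE expectation_noise_mul.
Qed.

End joint.

Theorem mainTheorem1 (R : realType) (N : nat) (G : weighted_graph R N)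
    (S : 'M[R]_N) (hS : graph_shift G S) (hSsym : S^T = S)
    (d : measure_display) (T : measurableType d) (P : probability T R)
    (x : T -> 'cV[R]_N) (hx : random_signal x) :
  stationary P S x <-> filtered_white_noise P S x.
Proof.
split=> [[x2 xm xS]|[d' [T' [P' [pi [PP' [H [e [HS [e2 em ec] xHe]]]]]]]]].
  have [H [K [HS KS HH HKH HK]]] :=
    polynomial_filter_sqrt hSsym (psdmx_cov x2) xS.
  have H_sym := polynomial_filter_sym hSsym HS.
  have K_sym := polynomial_filter_sym hSsym KS.
  set C := cov P x in xS HH.
  (* [Q] projects onto the directions that [H] kills, where the added noise must supply the missing
     variance. *)
  pose y := joint_noise x; pose Q := 1%:M - H *m K.
  have y2 := second_order_joint_noise hx x2.
  have ym := mean_joint_noise hx x2 xm.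
  have yc := cov_joint_noise hx x2 xm.
  have Q_sym : Q^T = Q by rewrite linearB/= trmx1 trmx_mul H_sym K_sym -HK.
  have QH : Q *m H = 0 by rewrite mulmxBl mul1mx HKH subrr.
  exists _, _, (noise_prob P N), noise_fst; split; first exact: noise_extension.
  exists H, (fun t => row_mx K Q *m y t); split=> //.
    split; first exact: second_order_mulmx.
      by rewrite mean_mulmx// ym mulmx0.
    rewrite cov_mulmx// yc mul_row_block tr_row_mx mul_row_col.
    rewrite !mulmx0 addr0 add0r mulmx1 Q_sym K_sym.
    (* By commutation [K H H K = H K H K = H K]. *)
    have -> : K *m C *m K = H *m K by rewrite -HH mulmxA -HK HKH.
    by rewrite {2}/Q mulmxBr mulmx1 mulmxA QH mul0mx subr0 addrC subrK.
  (* Since [H *m Q = 0], the added noise disappears and the residual depends on [x] alone. *)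
  have xE t : x (noise_fst t) - H *m (row_mx K Q *m y t) = row_mx Q 0 *m y t.
    rewrite !mul_row_col mul0mx addr0 mulmxDr !mulmxA.
    have -> : H *m Q = 0.
      by rewrite -[LHS]trmxK trmx_mul Q_sym H_sym QH trmx0.
    by rewrite mul0mx addr0 mulmxBl mul1mx.
  have : {ae noise_prob P N, forall t, row_mx Q 0 *m y t = 0}.
    apply: ae_eq0_cov0; first exact: second_order_mulmx.
      by rewrite mean_mulmx// ym mulmx0.
    (* The residual has covariance [Q C Q^T], which is zero because [C = H *m H] and
       [Q *m H = 0]. *)
    rewrite cov_mulmx// yc mul_row_block !mul0mx !mulmx0 !addr0 -/C -HH.
    by rewrite mulmxA QH mul0mx tr_row_mx mul_row_col !mul0mx addr0.
  by apply: filterS => t; rewrite -xE => /eqP; rewrite subr_eq0 => /eqP.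
(* Converse: [x \o pi] inherits the moments of [H e] on the larger space, and the extension hands
   them back to [x]. *)
have He2 := second_order_mulmx H e2.
have [x'2 x'm x'c] :=
  ae_eq_second_order (extension_random_signal pi hx) He2 xHe.
split; first exact/(extension_second_order PP' hx).
  by rewrite -(extension_mean PP' hx x'2) x'm mean_mulmx// em mulmx0.
rewrite -(extension_cov PP' hx x'2) x'c cov_mulmx// ec mulmx1.
by rewrite (polynomial_filter_sym hSsym HS); exact: polynomial_filter_sqr.
Qed.
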